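(* Let $f$ be an admissible kernel profile in dimension $d$ with associated multiscale kernel $K$, let $\alpha$ be a Borel probability measure on $\mathbb{R}^d$, and fix $u,v,x\in\mathbb{R}^d$ and $\sigma>0$. Consider the real random variable $$z_{uv}=z_{uv}(y)=\langle y-x,u\rangle\,\langle y-x,v\rangle\,K(x,y,\sigma),$$ where $y$ has distribution $\alpha$. Then $z_{uv}$ has finite variance $\sigma_{uv}^2$. Moreover, if $z_i$, $i\in\mathbb{N}$, are i.i.d. random variables with the same distribution as $z_{uv}$, then $$\sqrt n\left(\frac1n\sum_{i=1}^nz_i-\Sigma_\alpha(x,\sigma)(u,v)\right)\xrightarrow{d}\mathcal{N}(0,\sigma_{uv}^2)$$ as $n\to\infty$, where convergence is in distribution and $\mathcal{N}(0,\sigma_{uv}^2)$ is normally distributed with mean zero and variance $\sigma_{uv}^2$.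
   Context: An admissible kernel profile in dimension $d$ is a bounded measurable function $f\colon[0,\infty)\to\mathbb{R}$ such that (a) $f(r)\ge 0$ for all $r$; (b) $M_d=\int_0^\infty r^{\frac d2-1}f(r)\,dr<\infty$; (c) there is $C>0$ with $rf(r)\le C$ for all $r\ge0$; normalized so that $\sup f=1$, and with $M_d>0$. The associated multiscale kernel is $K(x,y,\sigma)=\frac{1}{C_d(\sigma)}f\!\left(\frac{\|y-x\|^2}{\sigma^2}\right)$, where $C_d(\sigma)=\frac12\sigma^dM_d\,\omega_{d-1}$ and $\omega_{d-1}=2\pi^{d/2}/\Gamma(d/2)$. The covariance tensor field is $\Sigma_\alpha(x,\sigma)=\int_{\mathbb{R}^d}(y-x)\otimes(y-x)K(x,y,\sigma)\,\alpha(dy)$, viewed as a bilinear form through $(x\otimes y)(u,v)=\langle x,u\rangle\langle y,v\rangle$; thus $\Sigma_\alpha(x,\sigma)(u,v)=\int\langle y-x,u\rangle\langle y-x,v\rangle K(x,y,\sigma)\,\alpha(dy)$. A normal distribution with variance $0$ is understood as the point mass at the mean. *)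

(* Defs.v *)
From HB Require Import structures.
From mathcomp Require Import all_boot all_order all_algebra finmap.
From mathcomp Require Import all_classical all_reals all_analysis
  measurable_realfun.

Set Implicit Arguments.
Unset Strict Implicit.
Unset Printing Implicit Defensive.

Import Order.TTheory GRing.Theory Num.Theory.
Import numFieldNormedType.Exports.

Local Open Scope classical_set_scope.
Local Open Scope ring_scope.

Section Euclidean.
Context {R : realType} {d : nat}.
Implicit Types u v x y : 'rV[R]_d.

Definition dotp u v : R := \sum_(i < d) u 0 i * v 0 i.

(* The library norm on 'rV[R]_d is the sup norm, so the Euclidean one is
   defined separately. *)
Definition enorm u : R := Num.sqrt (dotp u u).

(* Elements of R^d (x) R^d are d x d matrices of coordinates in the canonical
   basis. *)
Definition tensor x y : 'M[R]_d := x^T *m y.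

Definition tensor_form (T : 'M[R]_d) u v : R := (u *m T *m v^T) 0 0.

Lemma tensor_formE x y u v :
  tensor_form (tensor x y) u v = dotp x u * dotp y v.
Proof.
rewrite /tensor_form /tensor /dotp !mulmxA -mulmxA mxE big_ord1 !mxE.
by congr (_ * _); apply: eq_bigr => i _; rewrite mxE // mulrC.
Qed.

End Euclidean.

(* R^d with its Borel sigma-algebra (the topology of 'rV[R]_d is the product
   topology). *)
Definition borel_rV (R : realType) (d : nat) :=
  g_sigma_algebraType (@open 'rV[R]_d).

Section Kernel.
Context {R : realType}.
Local Notation mu := (@lebesgue_measure R).

Definition Gamma_fun (s : R) : R :=
  \int[mu]_(t in `[0%R, +oo[) (t `^ (s - 1) * expR (- t)).

Variables (d : nat) (f : R -> R).

Definition profile_moment : \bar R :=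
  (\int[mu]_(r in `[0%R, +oo[) (r `^ (d%:R / 2 - 1) * f r)%:E)%E.

(* Only the restriction of [f] to [0, +oo[ is constrained, and only that
   restriction enters the kernel. *)
Record admissible_profile : Prop := AdmissibleProfile {
  profile_measurable : measurable_fun `[(0 : R), +oo[ f ;
  profile_bounded : exists B : R, forall r : R, 0 <= r -> `|f r| <= B ;
  profile_ge0 : forall r : R, 0 <= r -> 0 <= f r ;
  profile_moment_lty : (profile_moment < +oo)%E ;
  profile_decay : exists2 C : R, 0 < C & forall r : R, 0 <= r -> r * f r <= C ;
  profile_sup : sup (f @` `[0, +oo[) = 1 ;
  profile_moment_gt0 : (0 < profile_moment)%E }.

(* [sphere_area] is omega_{d-1}. *)
Definition sphere_area : R := 2 * pi `^ (d%:R / 2) / Gamma_fun (d%:R / 2).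

Definition kernel_cst (sigma : R) : R :=
  2^-1 * sigma ^+ d * fine profile_moment * sphere_area.

Definition multiscale_kernel (x y : 'rV[R]_d) (sigma : R) : R :=
  (kernel_cst sigma)^-1 * f (enorm (y - x) ^+ 2 / sigma ^+ 2).

(* The tensor-valued integral is taken coordinatewise. *)
Definition covariance_tensor (alpha : probability (borel_rV R d) R)
    (x : 'rV[R]_d) (sigma : R) : 'M[R]_d :=
  \matrix_(i, j) \int[alpha]_y
    (tensor (y - x) (y - x) i j * multiscale_kernel x y sigma).

Definition z_var (u v x : 'rV[R]_d) (sigma : R) (y : borel_rV R d) : R :=
  dotp (y - x) u * dotp (y - x) v * multiscale_kernel x y sigma.

End Kernel.

Section Probability.
Context {dO : measure_display} {Omega : measurableType dO} {R : realType}.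
Variable P : probability Omega R.

Definition mutually_independent (I : choiceType) (Z : I -> {RV P >-> R}) :=
  forall (J : {fset I}) (B : I -> set R), (forall i, measurable (B i)) ->
  P (\bigcap_(i in [set` J]) (Z i @^-1` B i)) =
  (\prod_(i <- J) P (Z i @^-1` B i))%E.

Definition iid (I : choiceType) (Z : I -> {RV P >-> R})
    (law : set R -> \bar R) :=
  mutually_independent Z /\
  forall i (B : set R), measurable B -> distribution P (Z i) B = law B.

Definition cvg_in_distribution (X : nat -> {RV P >-> R})
    (nu : probability (measurableTypeR R) R) :=
  forall t : R, {for t, continuous (fun s : R => nu `]-oo, s]%classic)} ->
  cdf (X n) t @[n --> \oo] --> nu `]-oo, t]%classic.

Definition scaled_error (Z : nat -> {RV P >-> R}) (m : R) (n : nat)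
    (w : Omega) : R :=
  Num.sqrt n%:R * (n%:R^-1 * (\sum_(i < n) Z i w) - m).

Lemma measurable_scaled_error (Z : nat -> {RV P >-> R}) (m : R) (n : nat) :
  measurable_fun [set: Omega] (scaled_error Z m n).
Proof.
apply: measurable_funM => //; apply: measurable_funB => //.
apply: measurable_funM => //; apply: measurable_sum => i.
exact: measurable_funPT.
Qed.

HB.instance Definition _ (Z : nat -> {RV P >-> R}) (m : R) (n : nat) :=
  isMeasurableFun.Build _ _ _ _ (scaled_error Z m n)
    (measurable_scaled_error Z m n).

End Probability.

(* [normal_prob m s] takes the standard deviation, and for [s = 0] it is by
   convention the uniform law on [0, 1] rather than the point mass. *)
Definition normal_law {R : realType} (m var : R) :
    probability (measurableTypeR R) R :=
  if var == 0 then
    (dirac (m : measurableTypeR R) : probability (measurableTypeR R) R)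
  else (normal_prob m (Num.sqrt var) : probability (measurableTypeR R) R).

(* Main.v *)
(* Since r f(r) is bounded, so is z_uv, and the claim is the central limit
   theorem for bounded i.i.d. variables, proved here by Stein's method.  For a
   Lipschitz h with values in [0, 1] and p the density of N(0, s^2), the equation
     s^2 g' - x g = h - \int h p
   is solved by g(x) = (s^2 p(x))^-1 \int_(-oo, x] (h - \int h p) p; Mills' ratio
   bounds g and g', and then g' is Lipschitz up to a factor 1 + |x|.  If W is the
   normalised sum of n centred independent terms, removing one term from W and
   expanding g to first order shows that E[s^2 g'(W) - W g(W)] = O(n^(-1/2)).
   Piecewise linear functions h sandwich the indicators of half-lines, which
   gives convergence of the distribution functions. *)

Require Import Defs.
From HB Require Import structures.
From mathcomp Require Import all_boot all_order all_algebra finmap.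
From mathcomp Require Import all_classical all_reals all_analysis
  measurable_realfun.
From mathcomp Require Import ring lra.

Set Implicit Arguments.
Unset Strict Implicit.
Unset Printing Implicit Defensive.

Import Order.TTheory GRing.Theory Num.Theory.
Import numFieldNormedType.Exports.

Local Open Scope classical_set_scope.
Local Open Scope ring_scope.

(** * Stein's equation *)

(** Solving Stein's equation takes only first-order calculus on the line, but the Lipschitz bound
    for g' is not uniform: a difference of values of x g(x) contains y (g(x) - g(y)), whence the
    weight 1 + |y|. It does no harm, because it is evaluated only at sums with one term left out,
    whose normalised second moment is at most s^2. The rate comes from splitting s^2 g'(W) into n
    equal shares, one per summand: in each share the contribution of order n^(-1/2) has mean 0 by
    centring, that of order 1/n by the matching variance, and n remainders of order n^(-3/2) are
    left. Three obstacles shape the rest. The equation divides by s^2, so variance 0 needs its own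
    argument. Only the law of each variable is prescribed, so bounds on it hold almost surely and
    truncation is needed. Independence is given for finite families of events, whereas the expansion
    uses independence of one variable from the sum of others. *)

Section Stein.
Context {R : realType}.
Local Notation mu := (@lebesgue_measure R).

Section density.
Variables (s : R) (s_gt0 : 0 < s).
Local Notation p := (normal_pdf 0 s).

Let s_neq0 : s != 0. Proof. by rewrite gt_eqF. Qed.

Lemma normal_pdf0E x :
  p x = normal_peak s * expR (- (2 * s ^+ 2)^-1 * x ^+ 2).
Proof.
rewrite normal_pdfE // /normal_fun subr0; congr (_ * expR _).
by rewrite -mulr_natl mulrC mulrN mulNr.
Qed.

Lemma normal_pdf0_gt0 x : 0 < p x.
Proof. by rewrite normal_pdf0E mulr_gt0 ?expR_gt0 // normal_peak_gt0. Qed.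

Lemma normal_pdf0N x : p (- x) = p x.
Proof. by rewrite !normal_pdf0E sqrrN. Qed.

Lemma is_derive_normal_pdf0 (x : R) : is_derive x 1 p (- x / s ^+ 2 * p x).
Proof.
have -> : p = (fun x => normal_peak s * expR (- (2 * s ^+ 2)^-1 * x ^+ 2)).
  by apply/funext => y; exact: normal_pdf0E.
apply: is_derive_eq; rewrite /= /GRing.scale /=.
by field.
Qed.

Lemma cvg_normal_pdf0_pinfty : p x @[x --> +oo] --> 0.
Proof.
have -> : p = (fun x => normal_peak s *
                 gauss_fun (x * (Num.sqrt (2 * s ^+ 2))^-1)).
  apply/funext => x; rewrite normal_pdf0E /gauss_fun exprMn exprVn sqr_sqrtr.
    by congr (_ * expR _); ring.
  by rewrite mulr_ge0 // sqr_ge0.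
rewrite -(mulr0 (normal_peak s)); apply: cvgM; first exact: cvg_cst.
apply: (@cvg_comp _ _ _ _ _ _ (+oo : set_system R)); last exact: cvg_gauss_fun.
apply: gt0_cvgMly; last exact: cvg_id.
by rewrite invr_gt0 sqrtr_gt0 mulr_gt0 // exprn_gt0.
Qed.

(** On the half-line [x <= y], so [x * p y <= y * p y], and [- s ^+ 2 * p] is an antiderivative of
    [y * p y] that vanishes at infinity. *)
Lemma mills_ratio x : 0 < x ->
  x * \int[mu]_(y in `[x, +oo[) p y <= s ^+ 2 * p x.
Proof.
move=> x0.
have mp : measurable_fun setT p by exact: measurable_normal_pdf.
have intp : mu.-integrable `[x, +oo[ (EFin \o p).
  by apply: integrableS (integrable_normal_pdf 0 s).
have cid : continuous (fun y : R => y) by move=> y; exact: cvg_id.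
have FTC : (\int[mu]_(y in `[x, +oo[) (y * p y)%:E = (s ^+ 2 * p x)%:E)%E.
  rewrite (@ge0_continuous_FTC2y R _ (fun y => - s ^+ 2 * p y) x 0).
  - by rewrite sub0e -EFinN mulNr opprK.
  - by move=> y xy; rewrite mulr_ge0 ?normal_pdf_ge0// (le_trans (ltW x0)).
  - apply: continuous_subspaceT => y.
    apply: cvgM; [exact: cid | exact: continuous_normal_pdf].
  - rewrite -[X in _ --> X](mulr0 (- s ^+ 2)); apply: cvgM; first exact: cvg_cst.
    exact: cvg_normal_pdf0_pinfty.
  - move=> y _; have := is_derive_normal_pdf0 y => Dp.
    by apply: ex_derive.
  - apply: cvg_at_right_filter; apply: cvgM; first exact: cvg_cst.
    exact: continuous_normal_pdf.
  - move=> y _; have Dp := is_derive_normal_pdf0 y.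
    rewrite derive1E derive_val /GRing.scale /=; field.
    exact: s_neq0.
rewrite -RintegralZl// /Rintegral -[leRHS]/(fine (s ^+ 2 * p x)%:E) -FTC.
have mxp : measurable_fun (`[x, +oo[ : set R) (fun y => (y * p y)%:E).
  apply/measurable_EFinP/measurable_funM => //.
  by apply: measurable_funS mp.
have mcp : measurable_fun (`[x, +oo[ : set R) (fun y => (x * p y)%:E).
  apply/measurable_EFinP/measurable_funM => //.
  by apply: measurable_funS mp.
have le_xp : (\int[mu]_(y in `[x, +oo[) (x * p y)%:E <=
              \int[mu]_(y in `[x, +oo[) (y * p y)%:E)%E.
  apply: ge0_le_integral => //.
  - by move=> y _; rewrite lee_fin mulr_ge0 ?normal_pdf_ge0 // ltW.
  - by move=> y /=; rewrite in_itv /= andbT => xy;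
      rewrite lee_fin ler_wpM2r ?normal_pdf_ge0.
apply: fine_le => //; last by rewrite FTC.
rewrite ge0_fin_numE; first by rewrite (le_lt_trans le_xp) // FTC ltry.
by apply: integral_ge0 => y _; rewrite lee_fin mulr_ge0 ?normal_pdf_ge0 // ltW.
Qed.

Lemma normal_lower_tail x :
  \int[mu]_(y in `]-oo, (- x)]) p y = \int[mu]_(y in `[x, +oo[) p y.
Proof.
rewrite /Rintegral ge0_integration_by_substitutionNy.
- by congr fine; apply: eq_integral => y _ /=; rewrite normal_pdf0N.
- by apply: continuous_subspaceT => y; exact: continuous_normal_pdf.
- by move=> y _; exact: normal_pdf_ge0.
Qed.

Lemma le1_Rintegral_normal_pdf0 (D : set R) : measurable D ->
  \int[mu]_(y in D) p y <= 1.
Proof.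
move=> mD; have := @probability_le1 _ _ _ (normal_prob 0 s) D mD.
rewrite /normal_prob -lee_fin /Rintegral fineK //.
apply: integrable_fin_num => //.
by apply: integrableS (integrable_normal_pdf 0 s).
Qed.

(** * The explicit solution of the equation and its bounds *)

Section equation.
Variables (h : R -> R) (h_cont : continuous h)
  (h_itv : forall x, 0 <= h x <= 1).

Let m := \int[mu]_x (h x * p x).
Let q x := (h x - m) * p x.
Let G x := \int[mu]_(y in `]-oo, x]) q y.

Let intp D : measurable D -> mu.-integrable D (EFin \o p).
Proof. by move=> mD; apply: integrableS (integrable_normal_pdf 0 s). Qed.

Let mp : measurable_fun setT p.
Proof. exact: measurable_normal_pdf. Qed.

Let mh : measurable_fun setT h.
Proof. exact: continuous_measurable_fun. Qed.

Let int_dom (g : R -> R) D : measurable D -> measurable_fun setT g ->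
  (forall x, `|g x| <= p x) -> mu.-integrable D (EFin \o g).
Proof.
move=> mD mg gp; apply: (le_integrable mD _ _ (intp mD)).
  by apply/measurable_EFinP; exact: measurable_funS mg.
move=> x _ /=; rewrite lee_fin; apply: (le_trans (gp x)).
by rewrite ler_norm.
Qed.

Let int_hp D : measurable D -> mu.-integrable D (EFin \o (fun x => h x * p x)).
Proof.
move=> mD; apply: int_dom => //; first exact: measurable_funM.
move=> x; have /andP[h0 h1] := h_itv x.
by rewrite normrM !ger0_norm ?normal_pdf_ge0 // ler_piMl ?normal_pdf_ge0.
Qed.

Let m_itv : 0 <= m <= 1.
Proof.
apply/andP; split.
  apply: Rintegral_ge0 => x _; have /andP[h0 h1] := h_itv x.
  by rewrite mulr_ge0 ?normal_pdf_ge0.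
apply: le_trans (le1_Rintegral_normal_pdf0 measurableT).
apply: le_Rintegral => //; [exact: int_hp | exact: intp |] => x _.
by have /andP[h0 h1] := h_itv x; rewrite ler_piMl ?normal_pdf_ge0.
Qed.

Let normr_hm x : `|h x - m| <= 1.
Proof.
have /andP[h0 h1] := h_itv x; have /andP[m0 m1] := m_itv.
by rewrite ler_norml; apply/andP; split; lra.
Qed.

Let normr_q x : `|q x| <= p x.
Proof.
rewrite normrM (ger0_norm (normal_pdf_ge0 _ _ _)).
by rewrite ler_piMl ?normal_pdf_ge0.
Qed.

Let mq : measurable_fun setT q.
Proof. by apply: measurable_funM => //; exact: measurable_funB. Qed.

Let int_q D : measurable D -> mu.-integrable D (EFin \o q).
Proof. by move=> mD; exact: int_dom. Qed.

Let normr_int_q D : measurable D ->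
  `|\int[mu]_(y in D) q y| <= \int[mu]_(y in D) p y.
Proof.
move=> mD; apply: (le_trans (le_normr_Rintegral mD (int_q mD))).
apply: le_Rintegral => //; last exact: intp.
by apply: int_dom => //; [exact: measurableT_comp | move=> x; rewrite normr_id].
Qed.

Let int_qT : \int[mu]_y q y = 0.
Proof.
rewrite (_ : q = fun y => h y * p y - m * p y); last first.
  by apply/funext => y; rewrite /q mulrBl.
rewrite RintegralB //; last 2 first.
- exact: int_hp.
- apply: int_dom => //; first exact: measurable_funM.
  move=> x; have /andP[m0 m1] := m_itv.
  by rewrite normrM !ger0_norm ?normal_pdf_ge0 // ler_piMl ?normal_pdf_ge0.
rewrite RintegralZl //; last exact: intp.
by rewrite {2}/Rintegral integral_normal_pdf /= mulr1 subrr.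
Qed.

Let G_upper x : G x = - \int[mu]_(y in `]x, +oo[) q y.
Proof.
have := @Rintegral_itvB _ q -oo%O +oo%O x.
rewrite set_itvNyy int_qT sub0r => <- //.
- by rewrite opprK.
- exact: int_q.
Qed.

Let is_derive_G (x : R) : is_derive x 1 G (q x).
Proof.
(* Any right end beyond [x] would do in place of [x + 1]. *)
have [] := @continuous_FTC1 _ q -oo%O x (x + 1) _ _ _ _.
- by rewrite ltrDl.
- exact: int_q.
- by rewrite ltNyr.
- apply: cvgM; last exact: continuous_normal_pdf.
  by apply: cvgB; [exact: h_cont | exact: cvg_cst].
by move=> dG GE; apply: DeriveDef => //; rewrite -derive1E.
Qed.

Let f x := G x / (s ^+ 2 * p x).
(** Read off from the equation, which therefore holds by definition; the content is that this is
    indeed the derivative of [f]. *)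
Let f' x := (h x - m + x * f x) / s ^+ 2.

(** Quotient rule with [G' = q = (h - m) p] and [p' / p = - x / s ^+ 2]. *)
Let is_derive_f (x : R) : is_derive x 1 f (f' x).
Proof.
have p0 : p x != 0 by rewrite gt_eqF ?normal_pdf0_gt0.
have Dp := is_derive_normal_pdf0 x.
have DG := is_derive_G x.
have -> : f = (fun x => s ^- 2 * (G x * (p x)^-1)).
  by apply/funext => y; rewrite /f invfM mulrCA mulrA.
apply: is_derive_eq; rewrite /f' /f /q /GRing.scale /=; field.
by rewrite p0 s_neq0.
Qed.

(* [q] has total mass 0, so [G] is also minus an upper tail and Mills' ratio
   applies on both half-lines. *)
Let normr_G_le x : `|x| * `|G x| <= s ^+ 2 * p x.
Proof.
have [x0|x0|<-] := ltgtP 0 x.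
- rewrite (gtr0_norm x0); apply: le_trans (mills_ratio x0).
  rewrite ler_pM2l // G_upper normrN.
  rewrite Rintegral_itv_obnd_cbnd; last exact: int_q.
  exact: normr_int_q.
- rewrite (ltr0_norm x0) -(normal_pdf0N x).
  apply: le_trans (mills_ratio _); last by rewrite oppr_gt0.
  rewrite ler_pM2l ?oppr_gt0 // -normal_lower_tail opprK.
  exact: normr_int_q.
- by rewrite normr0 mul0r mulr_ge0 ?sqr_ge0 ?normal_pdf_ge0.
Qed.

Let normr_xf x : `|x * f x| <= 1.
Proof.
have d0 : 0 < s ^+ 2 * p x by rewrite mulr_gt0 ?exprn_gt0 ?normal_pdf0_gt0.
rewrite /f mulrA normrM normrV ?unitfE ?gt_eqF // (gtr0_norm d0).
by rewrite ler_pdivrMr // mul1r normrM normr_G_le.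
Qed.

(** The two summands serve two regions. If |x| >= 1, then |f x| <= |x f x| <= 1. If |x| < 1, then |G
    x| <= 1 while [p x >= p 1]. *)
Let f_bounded x : `|f x| <= 1 + (s ^+ 2 * p 1)^-1.
Proof.
have d1 : 0 < s ^+ 2 * p 1 by rewrite mulr_gt0 ?exprn_gt0 ?normal_pdf0_gt0.
have [x1|x1] := leP 1 `|x|.
  apply: (@le_trans _ _ 1); last by rewrite lerDl invr_ge0 ltW.
  by apply: le_trans (normr_xf x); rewrite [leRHS]normrM ler_peMl.
apply: (@le_trans _ _ (s ^+ 2 * p 1)^-1); last by rewrite lerDr.
have dx : 0 < s ^+ 2 * p x by rewrite mulr_gt0 ?exprn_gt0 ?normal_pdf0_gt0.
rewrite /f normrM normrV ?unitfE ?gt_eqF // (gtr0_norm dx).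
rewrite -[leRHS]mul1r; apply: ler_pM => //; first by rewrite invr_ge0 ltW.
  by apply: le_trans (normr_int_q _) _ => //; exact: le1_Rintegral_normal_pdf0.
rewrite lef_pV2 ?posrE // ler_pM2l ?exprn_gt0 // !normal_pdf0E.
rewrite ler_pM2l ?normal_peak_gt0 // ler_expR !mulNr lerN2 ler_pM2l.
  by rewrite expr1n -real_normK ?num_real // expr_le1 // ltW.
by rewrite invr_gt0 mulr_gt0 // exprn_gt0.
Qed.

Lemma stein_solution (L : R) :
  0 <= L -> (forall x y, `|h x - h y| <= L * `|x - y|) ->
  exists (g g' : R -> R) (K : R), [/\ continuous g, measurable_fun setT g',
    (forall x, `|g x| <= K), (forall x, `|g' x| <= K) &
    [/\ forall x, s ^+ 2 * g' x - x * g x =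
          h x - \int[mu]_x (h x * p x),
      forall x y, `|g' x - g' y| <= K * (1 + `|y|) * `|x - y| &
      forall x y,
        `|g x - g y - g' y * (x - y)| <= K * (1 + `|y|) * `|x - y| ^+ 2]].
Proof.
move=> L0 hL; pose B := 1 + (s ^+ 2 * p 1)^-1.
have B0 : 0 <= B.
  by rewrite addr_ge0 // invr_ge0 mulr_ge0 ?sqr_ge0 ?normal_pdf_ge0.
have s2 : 0 < s ^+ 2 by rewrite exprn_gt0.
have cf : continuous f.
  move=> x; have Df := is_derive_f x.
  by apply/differentiable_continuous/derivable1_diffP.
(* Mean value theorem for either order of [x] and [y]; of the intermediate point only its distance
   to [y] matters later. *)
have MVTf x y : exists2 c, `|c - y| <= `|x - y| & f x - f y = f' c * (x - y).
  have cw a b : {within `[a, b], continuous f} by exact: continuous_subspaceT.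
  have [yx|xy] := leP y x.
    have [c cyx E] := MVT_segment yx (fun z _ => is_derive_f z) (cw _ _).
    exists c => //; move: cyx; rewrite in_itv /= => /andP[yc cx].
    by rewrite !ger0_norm ?subr_ge0 // lerB.
  have [c cyx E] := MVT_segment (ltW xy) (fun z _ => is_derive_f z) (cw _ _).
  exists c; last by rewrite -[LHS]opprB E -mulrN opprB.
  move: cyx; rewrite in_itv /= => /andP[yc cx].
  rewrite !(distrC _ y) !ger0_norm ?subr_ge0 //; last exact: ltW.
  by rewrite lerB.
(* The 2 is the sum of the bounds 1 for |h - m| and 1 for |x f x|. *)
pose D := 2 / s ^+ 2.
have D0 : 0 <= D by rewrite divr_ge0 // ltW.
have f'D x : `|f' x| <= D.
  rewrite /f' normrM (gtr0_norm (_ : 0 < (s ^+ 2)^-1)) ?invr_gt0 //.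
  rewrite ler_pM2r ?invr_gt0 //; apply: (le_trans (ler_normD _ _)).
  by have := normr_hm x; have := normr_xf x; lra.
have f_lip x y : `|f x - f y| <= D * `|x - y|.
  have [c _ ->] := MVTf x y.
  by rewrite normrM ler_wpM2r.
pose C := (L + B + D) / s ^+ 2.
have C0 : 0 <= C by rewrite divr_ge0 ?sqr_ge0 // addr_ge0 // addr_ge0.
have f'_lip x y : `|f' x - f' y| <= C * (1 + `|y|) * `|x - y|.
  (* The splitting x f(x) - y f(y) = f(x) (x - y) + y (f(x) - f(y)) gives the three summands of [C]
     and puts the factor |y| on the last one. *)
  have -> : f' x - f' y =
      (h x - h y + f x * (x - y) + y * (f x - f y)) / s ^+ 2.
    rewrite /f'; field; exact: s_neq0.
  rewrite normrM (gtr0_norm (_ : 0 < (s ^+ 2)^-1)) ?invr_gt0 //.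
  rewrite /C -!mulrA (mulrC (s ^- 2)) !mulrA ler_pM2r ?invr_gt0 //.
  apply: (le_trans (ler_normD _ _)).
  apply: (@le_trans _ _
    (L * `|x - y| + B * `|x - y| + `|y| * (D * `|x - y|))).
    apply: lerD; last by rewrite normrM ler_wpM2l.
    apply: (le_trans (ler_normD _ _)); apply: lerD; first exact: hL.
    by rewrite normrM ler_wpM2r //; exact: f_bounded.
  rewrite mulrA -!mulrDl ler_wpM2r //.
  have y0 := normr_ge0 y.
  by have := mulr_ge0 L0 y0; have := mulr_ge0 B0 y0; lra.
exists f, f', (B + D + C); split=> //.
- have -> : f' = (fun x => (h x - m + x * f x) * (s ^+ 2)^-1) by [].
  apply: measurable_funM => //; apply: measurable_funD.
    exact: measurable_funB.
  by apply: measurable_funM => //; exact: continuous_measurable_fun.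
- by move=> x; have : `|f x| <= B := f_bounded x; lra.
- by move=> x; have := f'D x; lra.
split.
- by move=> x; rewrite /f' mulrCA divff ?gt_eqF // mulr1 addrK.
- move=> x y; apply: (le_trans (f'_lip x y)).
  by rewrite ler_wpM2r // ler_wpM2r ?addr_ge0 //; lra.
(* The remainder equals [(f' c - f' y) * (x - y)] with [c] no farther from [y] than [x] is, so the
   Lipschitz bound for [f'] replaces a second derivative. *)
- move=> x y; have [c cxy ->] := MVTf x y.
  rewrite -mulrBl normrM expr2 mulrA ler_wpM2r //.
  apply: (le_trans (f'_lip c y)); apply: ler_pM => //.
    by rewrite mulr_ge0 // addr_ge0.
  by rewrite ler_wpM2r ?addr_ge0 //; lra.
Qed.

End equation.
End density.
End Stein.

(** * Bounded random variables and independence *)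

Section clamp.
Context {R : realType}.

(** Truncation to [-a, a]: it makes a function bounded without changing it where it already takes
    values in that interval. *)
Definition clamp (a x : R) : R := Num.max (- a) (Num.min a x).

Lemma clamp_id (a x : R) : `|x| <= a -> clamp a x = x.
Proof.
by rewrite ler_norml => /andP[ax xa]; rewrite /clamp (min_idPr xa) (max_idPr ax).
Qed.

Lemma normr_clamp (a x : R) : 0 <= a -> `|clamp a x| <= a.
Proof.
move=> a0; rewrite ler_norml le_max lexx /= ge_max ge_min lexx andbT.
by rewrite (le_trans _ a0) // oppr_le0.
Qed.

Lemma measurable_clamp (a : R) : measurable_fun setT (clamp a).
Proof. by apply: measurable_maxr => //; exact: measurable_minr. Qed.

End clamp.

Section bounded_measurable.
Context {d : measure_display} {T : measurableType d} {R : realType}.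
Implicit Types X Y : T -> R.

(** The bound holds everywhere rather than almost everywhere, so the class is an algebra that
    depends on no measure, and its members are integrable for every probability. *)
Definition bounded_measurable X :=
  measurable_fun setT X /\ exists a : R, forall w, `|X w| <= a.

Lemma bounded_measurable_cst (c : R) : bounded_measurable (fun=> c).
Proof. by split=> //; exists `|c|. Qed.

Lemma bounded_measurableD X Y : bounded_measurable X -> bounded_measurable Y ->
  bounded_measurable (fun w => X w + Y w).
Proof.
move=> [mX [a Xa]] [mY [b Yb]]; split; first exact: measurable_funD.
by exists (a + b) => w; rewrite (le_trans (ler_normD _ _)) // lerD.
Qed.

Lemma bounded_measurableM X Y : bounded_measurable X -> bounded_measurable Y ->
  bounded_measurable (fun w => X w * Y w).
Proof.
move=> [mX [a Xa]] [mY [b Yb]]; split; first exact: measurable_funM.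
by exists (a * b) => w; rewrite normrM ler_pM.
Qed.

Lemma bounded_measurableB X Y : bounded_measurable X -> bounded_measurable Y ->
  bounded_measurable (fun w => X w - Y w).
Proof.
move=> bX [mY [b Yb]]; apply: bounded_measurableD => //.
by split; [exact: measurableT_comp | exists b => w; rewrite normrN].
Qed.

Lemma bounded_measurable_norm X : bounded_measurable X ->
  bounded_measurable (fun w => `|X w|).
Proof.
move=> [mX [a Xa]]; split; first exact: measurableT_comp.
by exists a => w; rewrite normr_id.
Qed.

Lemma bounded_measurable_sum (I : Type) (r : seq I) (X : I -> T -> R) :
  (forall i, bounded_measurable (X i)) ->
  bounded_measurable (fun w => \sum_(i <- r) X i w).
Proof.
move=> bX; elim: r => [|i r IH].
  by under eq_fun do rewrite big_nil; exact: bounded_measurable_cst.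
by under eq_fun do rewrite big_cons; exact: bounded_measurableD.
Qed.

Lemma bounded_measurable_comp (g : R -> R) X (K : R) : measurable_fun setT g ->
  (forall x, `|g x| <= K) -> measurable_fun setT X ->
  bounded_measurable (fun w => g (X w)).
Proof.
by move=> mg gK mX; split; [exact: measurableT_comp | exists K => w].
Qed.

Variable P : probability T R.

Lemma bounded_measurable_integrable X : bounded_measurable X ->
  P.-integrable setT (EFin \o X).
Proof.
move=> [mX [a Xa]]; apply: measurable_bounded_integrable => //.
  by rewrite (le_lt_trans (probability_le1 _ _)) // ltry.
by exists a; split; [exact: num_real | move=> x ax w _; exact: le_trans (ltW ax)].
Qed.

Lemma expectation_Rintegral X : bounded_measurable X ->
  ('E_P[X] = (\int[P]_w X w)%:E)%E.
Proof.
move=> bX; rewrite unlock /Rintegral fineK //.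
exact: integrable_fin_num (bounded_measurable_integrable bX).
Qed.

Lemma Rintegral_probability_cst (c : R) : \int[P]_w c = c.
Proof.
rewrite Rintegral_cst // -[RHS]mulr1; congr (c * _).
exact: (congr1 fine (probability_setT P)).
Qed.

Lemma Rintegral_sum (I : Type) (r : seq I) (X : I -> T -> R) :
  (forall i, bounded_measurable (X i)) ->
  \int[P]_w (\sum_(i <- r) X i w) = \sum_(i <- r) \int[P]_w X i w.
Proof.
move=> bX; elim: r => [|i r IH].
  rewrite big_nil -[RHS](Rintegral_probability_cst 0).
  by apply: eq_Rintegral => w _; rewrite big_nil.
rewrite big_cons -IH -RintegralD //; last 2 first.
- exact: bounded_measurable_integrable.
- exact/bounded_measurable_integrable/bounded_measurable_sum.
by apply: eq_Rintegral => w _; rewrite big_cons.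
Qed.

End bounded_measurable.

(** * Product formulas for independent variables *)

Section independence.
Context {d : measure_display} {T : measurableType d} {R : realType}.
Variable P : probability T R.

Section pair.
Variables (X Y : {RV P >-> R}).
Hypothesis XY : forall A B : set R, measurable A -> measurable B ->
  P (X @^-1` A `&` Y @^-1` B) = (P (X @^-1` A) * P (Y @^-1` B))%E.

Let mXY : measurable_fun setT (fun w => (X w, Y w)).
Proof. by apply: measurable_fun_pair; exact: measurable_funPT. Qed.

Let XY_RV : {mfun T >-> (R * R)%type} := mfun_Sub (mem_set mXY).

(** Hypothesis [XY] is equality on rectangles, and these determine the product measure. *)
Lemma joint_distribution (A : set (R * R)) : measurable A ->
  (distribution P X \x distribution P Y)%E A = distribution P XY_RV A.
Proof.
by move=> mA; apply: product_measure_unique => // B C mB mC; exact: XY.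
Qed.

(** Passing to the joint law turns the left side into an integral over a product measure, and Fubini
    splits it. *)
Let independent_RintegralM_bounded (g k : R -> R) (a b : R) :
  measurable_fun setT g -> measurable_fun setT k ->
  (forall x, `|g x| <= a) -> (forall x, `|k x| <= b) ->
  \int[P]_w (g (X w) * k (Y w)) = (\int[P]_w g (X w)) * (\int[P]_w k (Y w)).
Proof.
move=> mg mk ga kb.
have mgk : measurable_fun setT (fun z : R * R => g z.1 * k z.2).
  by apply: measurable_funM; apply: measurableT_comp.
have bgk : bounded_measurable (fun z : R * R => g z.1 * k z.2).
  by split=> //; exists (a * b) => z; rewrite normrM ler_pM.
have bg : bounded_measurable (fun w => g (X w)).
  by apply: bounded_measurable_comp ga _ => //; exact: measurable_funPT.
have bk : bounded_measurable (fun w => k (Y w)).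
  by apply: bounded_measurable_comp kb _ => //; exact: measurable_funPT.
have bg1 : bounded_measurable g by split=> //; exists a.
have bk1 : bounded_measurable k by split=> //; exists b.
have EX : (\int[distribution P X]_x (g x)%:E = \int[P]_w (g (X w))%:E)%E.
  rewrite (@integral_distribution _ _ _ _ _ P X (EFin \o g)) //.
    exact/measurable_EFinP.
  exact: bounded_measurable_integrable.
have EY : (\int[distribution P Y]_x (k x)%:E = \int[P]_w (k (Y w))%:E)%E.
  rewrite (@integral_distribution _ _ _ _ _ P Y (EFin \o k)) //.
    exact/measurable_EFinP.
  exact: bounded_measurable_integrable.
have EXY : (\int[P]_w (g (X w) * k (Y w))%:E =
    \int[distribution P XY_RV]_z (g z.1 * k z.2)%:E)%E.
  rewrite (@integral_distribution _ _ _ _ _ P XY_RV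
    (fun z => (g z.1 * k z.2)%:E)) //.
    exact/measurable_EFinP.
  by apply: bounded_measurable_integrable; exact: bounded_measurableM.
rewrite /Rintegral EXY.
rewrite (@eq_measure_integral _ _ _ _ (distribution P X \x distribution P Y)%E);
  last by move=> A mA _; exact/esym/joint_distribution.
rewrite -integral12_prod_meas1; last exact: bounded_measurable_integrable.
have fin_k : (\int[P]_w (k (Y w))%:E)%E \is a fin_num.
  by apply: integrable_fin_num => //; exact: bounded_measurable_integrable.
have fin_g : (\int[P]_w (g (X w))%:E)%E \is a fin_num.
  by apply: integrable_fin_num => //; exact: bounded_measurable_integrable.
rewrite -fineM // -EX -(fineK fin_k) -integralZr //; last first.
  exact: bounded_measurable_integrable.
congr fine; apply: eq_integral => x _; rewrite /fubini_F /=.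
under eq_integral do rewrite EFinM.
rewrite integralZl //; last exact: bounded_measurable_integrable.
by rewrite EY fineK.
Qed.

(** Boundedness is asked only along [X] and [Y], so that [g] and [k] may be polynomials; clamping
    them at these bounds reduces to the bounded case. *)
Lemma independent_RintegralM (g k : R -> R) :
  measurable_fun setT g -> measurable_fun setT k ->
  bounded_measurable (fun w => g (X w)) ->
  bounded_measurable (fun w => k (Y w)) ->
  \int[P]_w (g (X w) * k (Y w)) = (\int[P]_w g (X w)) * (\int[P]_w k (Y w)).
Proof.
move=> mg mk [_ [a ga]] [_ [b kb]].
have a0 : 0 <= a by exact: le_trans (ga point).
have b0 : 0 <= b by exact: le_trans (kb point).
have mc (c : R) (h : R -> R) : measurable_fun setT h ->
    measurable_fun setT (clamp c \o h).
  by move=> mh; apply: measurableT_comp => //; exact: measurable_clamp.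
have := @independent_RintegralM_bounded (clamp a \o g) (clamp b \o k) a b
  (mc _ _ mg) (mc _ _ mk) (fun x => normr_clamp _ a0)
  (fun x => normr_clamp _ b0).
have clampE c (h : R -> R) (Z : T -> R) : (forall w, `|h (Z w)| <= c) ->
    (fun w => (clamp c \o h) (Z w)) = (fun w => h (Z w)).
  by move=> hc; apply/funext => w /=; rewrite clamp_id.
rewrite /Rintegral.
under eq_integral do rewrite /= !clamp_id //.
by rewrite /comp; move=> ->; congr (fine _ * fine _);
  apply: eq_integral => w _; rewrite clamp_id.
Qed.

End pair.

Lemma mutually_independent_comp (I : choiceType) (Z X : I -> {RV P >-> R})
    (phi : R -> R) : measurable_fun setT phi ->
  (forall i w, X i w = phi (Z i w)) ->
  mutually_independent Z -> mutually_independent X.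
Proof.
move=> mphi XZ indZ J B mB.
have XE i : X i @^-1` B i = Z i @^-1` (phi @^-1` B i).
  by apply/seteqP; split => w /=; rewrite XZ.
under eq_bigcapr do rewrite XE.
under eq_bigr do rewrite XE.
by apply: indZ => i; rewrite -[X in measurable X]setTI; exact: mphi.
Qed.

(** With [A] fixed, [E |-> P (Z i @^-1] A [&] E)[and]P (Z i @^-1[A)] times [P] are finite measures.
    Mutual independence makes them agree on cylinders over [r], hence on the sigma-algebra generated
    by these, which contains the events of [S]. *)
Lemma mutually_independent_sum (I : choiceType) (Z : I -> {RV P >-> R})
    (i : I) (r : seq I) (S : {RV P >-> R}) :
  mutually_independent Z -> i \notin r ->
  (forall w, S w = \sum_(j <- r) Z j w) ->
  forall A B : set R, measurable A -> measurable B ->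
  P (Z i @^-1` A `&` S @^-1` B) = (P (Z i @^-1` A) * P (S @^-1` B))%E.
Proof.
move=> indZ ir SE A B mA mB.
pose J := [fset j in r]%fset.
have iJ : i \notin J by rewrite !inE.
pose cyl (C : I -> set R) := \bigcap_(j in [set` J]) (Z j @^-1` C j).
(* A pi-system generating the sigma-algebra of the variables indexed by [r]. *)
pose G := [set E | exists2 C, (forall j, measurable (C j)) & E = cyl C].
have mZ j C : measurable C -> measurable (Z j @^-1` C).
  by move=> mC; rewrite -[X in measurable X]setTI; exact: measurable_funPT.
have mZA := mZ i A mA.
have GT : G setT.
  exists (fun=> setT) => //; rewrite /cyl.
  by apply/seteqP; split=> // w _ j _.
have Gm : G `<=` measurable.
  move=> _ [C mC ->]; apply: fin_bigcap_measurable => // j _; exact: mZ.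
have GI : setI_closed G.
  move=> _ _ [C mC ->] [D mD ->]; exists (fun j => C j `&` D j).
    by move=> j; exact: measurableI.
  by rewrite /cyl -bigcapI; apply: eq_bigcapr => j _; rewrite preimage_setI.
pose c : {nonneg R} := NngNum (fine_ge0 (measure_ge0 P (Z i @^-1` A))).
have cE : (c%:num%:E = P (Z i @^-1` A))%E.
  by rewrite /= fineK // fin_num_measure.
have agree E : <<s G >> E ->
    mrestr P mZA E = mscale c P E.
  apply: (@g_sigma_algebra_measure_unique _ _ _ G Gm (fun=> setT)) => //.
  - by rewrite bigcup_const.
  - move=> _ [C mC ->].
    change (P (cyl C `&` Z i @^-1` A) = c%:num%:E * P (cyl C))%E.
    rewrite cE.
    pose C' j := if j == i then A else C j.
    have mC' j : measurable (C' j) by rewrite /C'; case: ifP.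
    have CE j : j \in J -> C' j = C j.
      by move=> jJ; rewrite /C'; case: eqP => // ji; rewrite ji (negbTE iJ) in jJ.
    have := indZ (i |` J)%fset C' mC'.
    rewrite big_fsetU1 //= {2}/C' eqxx.
    rewrite (eq_big_seq (fun j => P (Z j @^-1` C j))); last first.
      by move=> j jJ; rewrite CE.
    rewrite -indZ // => <-; congr (P _); apply/seteqP; split.
      move=> w [wC wA] j /=; rewrite in_fset1U => /orP[/eqP->|jJ].
        by rewrite /C' eqxx.
      by rewrite CE //; exact: wC.
    move=> w wC; split.
      move=> j jJ; rewrite -CE //; apply: wC => /=.
      by rewrite in_fset1U jJ orbT.
    by have := wC i; rewrite /C' eqxx; apply => /=; rewrite in_fset1U eqxx.
  - move=> _; rewrite /mrestr.
    by rewrite (le_lt_trans (probability_le1 _ _)) ?ltry // setTI.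
have GS : <<s G >> (S @^-1` B).
  have mS : measurable_fun (setT : set (g_sigma_algebraType G))
      (fun w => \sum_(j <- r) Z j w : R).
    (* The induction runs over a sublist [r'], while the sigma-algebra remains the one attached to
       [r]. *)
    have: {subset r <= r} by [].
    elim: {1 3}r => [|j r' IH] rr'.
      by under eq_fun do rewrite big_nil; exact: measurable_cst.
    under eq_fun do rewrite big_cons.
    apply: measurable_funD; last first.
      by apply: IH => k kr'; apply: rr'; rewrite inE kr' orbT.
    move=> _ C mC; rewrite setTI; apply: sub_sigma_algebra.
    exists (fun k => if k == j then C else setT); first by move=> k; case: ifP.
    apply/seteqP; split => w /=.
      by move=> wC k _ /=; case: eqP => // ->.
    move=> wC; have := wC j; rewrite /= eqxx; apply.
    by rewrite /J !inE rr' // mem_head.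
  have := mS measurableT B mB; rewrite setTI.
  congr (<<s G >> _); apply/seteqP; split => w /=; rewrite SE //.
rewrite -cE setIC; exact: agree.
Qed.

End independence.

(** * The bound given by Stein's equation *)

Section bounded_clt.
Context {d : measure_display} {T : measurableType d} {R : realType}.
Variables (P : probability T R) (X : nat -> {RV P >-> R}) (b s : R).
Hypotheses (indX : mutually_independent X) (s_gt0 : 0 < s)
  (Xb : forall i w, `|X i w| <= b) (EX : forall i, \int[P]_w X i w = 0)
  (EX2 : forall i, \int[P]_w (X i w ^+ 2) = s ^+ 2).

Let b_ge0 : 0 <= b. Proof. exact: le_trans (Xb 0 point). Qed.

Let bX i : bounded_measurable (X i : T -> R).
Proof. by split; [exact: measurable_funPT | exists b]. Qed.

Let S (r : seq nat) : {RV P >-> R} :=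
  mfun_Sub (mem_set (measurable_sum r (fun i => @measurable_funPT _ _ _ _ (X i)))).

Let bS r : bounded_measurable (S r : T -> R).
Proof. exact: bounded_measurable_sum. Qed.

Let indXS i r : i \notin r -> forall A B : set R, measurable A -> measurable B ->
  P (X i @^-1` A `&` S r @^-1` B) = (P (X i @^-1` A) * P (S r @^-1` B))%E.
Proof. by move=> ir; exact: mutually_independent_sum indX ir _. Qed.

Let ED (U V : T -> R) : bounded_measurable U -> bounded_measurable V ->
  \int[P]_w (U w + V w) = \int[P]_w U w + \int[P]_w V w.
Proof. by move=> bU bV; rewrite RintegralD //; exact: bounded_measurable_integrable. Qed.

Let EB (U V : T -> R) : bounded_measurable U -> bounded_measurable V ->
  \int[P]_w (U w - V w) = \int[P]_w U w - \int[P]_w V w.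
Proof. by move=> bU bV; rewrite RintegralB //; exact: bounded_measurable_integrable. Qed.

Let EZ (k : R) (U : T -> R) : bounded_measurable U ->
  \int[P]_w (k * U w) = k * \int[P]_w U w.
Proof. by move=> bU; rewrite RintegralZl //; exact: bounded_measurable_integrable. Qed.

Let Ele (U V : T -> R) : bounded_measurable U -> bounded_measurable V ->
  (forall w, U w <= V w) -> \int[P]_w U w <= \int[P]_w V w.
Proof.
by move=> bU bV UV; apply: le_Rintegral => // ; exact: bounded_measurable_integrable.
Qed.

Let Ele_norm (U V : T -> R) : bounded_measurable U -> bounded_measurable V ->
  (forall w, `|U w| <= V w) -> `|\int[P]_w U w| <= \int[P]_w V w.
Proof.
move=> bU bV UV; apply: le_trans (le_normr_Rintegral _ _) _ => //.
  exact: bounded_measurable_integrable.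
by apply: Ele => //; exact: bounded_measurable_norm.
Qed.

(** Cross terms vanish, each new variable being centred and independent of the sum so far. *)
Let second_moment_sum r : uniq r ->
  \int[P]_w (S r w ^+ 2) = (size r)%:R * s ^+ 2.
Proof.
elim: r => [_|i r IH /= /andP[ir ur]].
  rewrite mul0r -[RHS](Rintegral_probability_cst P 0).
  by apply: eq_Rintegral => w _; rewrite /S /= big_nil expr0n.
have bX2 : bounded_measurable (fun w => X i w ^+ 2).
  by under eq_fun do rewrite expr2; exact: bounded_measurableM.
have bS2 : bounded_measurable (fun w => S r w ^+ 2).
  by under eq_fun do rewrite expr2; exact: bounded_measurableM.
have bXS : bounded_measurable (fun w => X i w * S r w).
  exact: bounded_measurableM.
rewrite (_ : \int[P]_w (S (i :: r) w ^+ 2) =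
  \int[P]_w (X i w ^+ 2 + S r w ^+ 2 + 2 * (X i w * S r w))); last first.
  by apply: eq_Rintegral => w _; rewrite /S /= big_cons; ring.
rewrite ED; last 2 first.
- exact: bounded_measurableD.
- by apply: bounded_measurableM => //; exact: bounded_measurable_cst.
have mid : measurable_fun setT (fun x : R => x) by exact: measurable_id.
have EXS := independent_RintegralM (indXS ir) mid mid (bX i) (bS r).
rewrite ED // EZ // EX2 IH // EXS.
by rewrite EX mul0r mulr0 addr0 -natr1 mulrDl mul1r addrC.
Qed.

Variables (h : R -> R) (L : R).
Hypotheses (h_cont : continuous h) (h_itv : forall x, 0 <= h x <= 1)
  (L_ge0 : 0 <= L) (h_lip : forall x y, `|h x - h y| <= L * `|x - y|).

Lemma stein_bound : exists C : R, forall n, (0 < n)%N ->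
  `|\int[P]_w h ((Num.sqrt n%:R)^-1 * \sum_(i < n) X i w) -
    \int[lebesgue_measure]_x (h x * normal_pdf 0 s x)| <=
  C * (Num.sqrt n%:R)^-1.
Proof.
have [f [f' [K [cf mf' fK f'K [steinE f'lip ftaylor]]]]] :=
  stein_solution s_gt0 h_cont h_itv L_ge0 h_lip.
have mf : measurable_fun setT f by exact: continuous_measurable_fun.
have mh : measurable_fun setT h by exact: continuous_measurable_fun.
have K0 : 0 <= K by exact: le_trans (fK 0).
(* [s ^+ 2 * b] comes from the increment of [f'], [b ^+ 3] from the Taylor remainder times one more
   summand, and [2 + s ^+ 2] bounds the mean of the weight 1 + |V|. *)
exists ((s ^+ 2 * b + b ^+ 3) * K * (2 + s ^+ 2)) => n n_gt0.
set c := (Num.sqrt n%:R)^-1.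
have c0 : 0 <= c by rewrite invr_ge0 sqrtr_ge0.
have c2 : c ^+ 2 = n%:R^-1 by rewrite exprVn sqr_sqrtr.
have n0 : n%:R != 0 :> R by rewrite pnatr_eq0 -lt0n.
pose r := index_iota 0 n.
have ur : uniq r by exact: iota_uniq.
pose W w := c * S r w.
have bc : bounded_measurable (fun _ : T => c) by exact: bounded_measurable_cst.
have bW : bounded_measurable W by exact: bounded_measurableM.
have bfW : bounded_measurable (fun w => f (W w)).
  by apply: bounded_measurable_comp fK _ => //; case: bW.
have bf'W : bounded_measurable (fun w => f' (W w)).
  by apply: bounded_measurable_comp f'K _ => //; case: bW.
have bhW : bounded_measurable (fun w => h (W w)).
  apply: (bounded_measurable_comp mh (K := 1)); last by case: bW.
  by move=> x; have /andP[h0 h1] := h_itv x; rewrite ger0_norm.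
pose term i w := s ^+ 2 * n%:R^-1 * f' (W w) - c * X i w * f (W w).
have bcX i : bounded_measurable (fun w => c * X i w).
  exact: bounded_measurableM.
have bterm i : bounded_measurable (term i).
  apply: bounded_measurableB; apply: bounded_measurableM => //.
  exact: bounded_measurable_cst.
set m := \int[lebesgue_measure]_x _.
have termE w : h (W w) - m = \sum_(i <- r) term i w.
  rewrite -steinE /term big_split /= sumrN -mulr_suml big_const_seq.
  rewrite count_predT size_iota subn0 iter_addr addr0.
  rewrite -[_ *+ n]mulr_natl mulrCA mulfV // mulr1 -mulr_suml -mulr_sumr.
  by [].
have -> : \int[P]_w h (c * \sum_(i < n) X i w) - m = \int[P]_w (h (W w) - m).
  rewrite EB //; last exact: bounded_measurable_cst.
  rewrite Rintegral_probability_cst; congr (_ - _).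
  by apply: eq_Rintegral => w _; rewrite /W /S /= /r big_mkord.
have -> : \int[P]_w (h (W w) - m) = \int[P]_w (\sum_(i <- r) term i w).
  by apply: eq_Rintegral => w _; rewrite termE.
rewrite Rintegral_sum //; apply: (le_trans (ler_norm_sum _ _ _)).
pose C1 := (s ^+ 2 * b + b ^+ 3) * K.
have C1_ge0 : 0 <= C1.
  apply: mulr_ge0 => //; apply: addr_ge0; last exact: exprn_ge0.
  by apply: mulr_ge0 => //; exact: sqr_ge0.
suff term_le i : i \in r ->
    `|\int[P]_w term i w| <= n%:R^-1 * c * (C1 * (2 + s ^+ 2)).
  rewrite big_seq; apply: (le_trans (ler_sum _ term_le)); rewrite -big_seq.
  rewrite big_const_seq count_predT size_iota subn0 iter_addr addr0.
  rewrite -[_ *+ n]mulr_natl -!mulrA mulVKf //.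
  by rewrite [leLHS]mulrC /C1 -!mulrA.
move=> ir.
pose r' := rem i r.
have ir' : i \notin r' by rewrite mem_rem_uniq // inE eqxx.
pose V w := c * S r' w.
have WV w : W w = V w + c * X i w.
  by rewrite /W /V /S /= (big_rem i) //= mulrDr addrC.
have bV : bounded_measurable V by exact: bounded_measurableM.
have mV : measurable_fun setT V by case: bV.
have bfV : bounded_measurable (fun w => f (V w)).
  exact: bounded_measurable_comp fK _.
have bf'V : bounded_measurable (fun w => f' (V w)).
  exact: bounded_measurable_comp f'K _.
(* Here 1 + |V| <= 2 + V^2, and V^2 has mean (n - 1) s^2 / n. *)
have EV : \int[P]_w (1 + `|V w|) <= 2 + s ^+ 2.
  have bV2 : bounded_measurable (fun w => S r' w ^+ 2).
    by under eq_fun do rewrite expr2; exact: bounded_measurableM.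
  apply: (@le_trans _ _ (\int[P]_w (2 + c ^+ 2 * S r' w ^+ 2))).
    apply: Ele.
    - apply: bounded_measurableD; first exact: bounded_measurable_cst.
      exact: bounded_measurable_norm.
    - apply: bounded_measurableD; first exact: bounded_measurable_cst.
      by apply: bounded_measurableM => //; exact: bounded_measurable_cst.
    move=> w; rewrite -exprMn -/(V w) -real_normK ?num_real //.
    have := sqr_ge0 (`|V w| - 1); have := normr_ge0 (V w); nra.
  rewrite ED; last 2 first.
  - exact: bounded_measurable_cst.
  - by apply: bounded_measurableM => //; exact: bounded_measurable_cst.
  rewrite Rintegral_probability_cst EZ // second_moment_sum ?rem_uniq //.
  rewrite lerD2l mulrA ler_piMl ?sqr_ge0 // c2 mulrC ler_pdivrMr ?ltr0n //.
  by rewrite mul1r ler_nat size_rem // size_iota subn0 leq_pred.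
(* [term i - D] is made of products of a function of [X i] of mean 0 with a
   function of the leave-one-out sum [V], hence has mean 0. *)
pose D w := s ^+ 2 * n%:R^-1 * (f' (W w) - f' (V w)) -
  c * X i w * (f (W w) - f (V w) - f' (V w) * (W w - V w)).
have bD : bounded_measurable D.
  apply: bounded_measurableB; apply: bounded_measurableM => //.
  - exact: bounded_measurable_cst.
  - exact: bounded_measurableB.
  - apply: bounded_measurableB; first exact: bounded_measurableB.
    by apply: bounded_measurableM => //; exact: bounded_measurableB.
have bq : bounded_measurable (fun w => s ^+ 2 * n%:R^-1 - (c * X i w) ^+ 2).
  apply: bounded_measurableB; first exact: bounded_measurable_cst.
  by under eq_fun do rewrite expr2; exact: bounded_measurableM.
have -> : \int[P]_w term i w = \int[P]_w D w.
  have -> : \int[P]_w term i w =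
      \int[P]_w (D w + (s ^+ 2 * n%:R^-1 - (c * X i w) ^+ 2) * f' (V w)
                 - c * X i w * f (V w)).
    by apply: eq_Rintegral => w _; rewrite /term /D WV; ring.
  have mcR : measurable_fun setT (fun x : R => c * x) by exact: measurable_funM.
  rewrite EB; last 2 first.
  - by apply: bounded_measurableD => //; exact: bounded_measurableM.
  - exact: bounded_measurableM.
  rewrite ED //; last exact: bounded_measurableM.
  have mq : measurable_fun setT (fun x : R => s ^+ 2 * n%:R^-1 - (c * x) ^+ 2).
    by apply: measurable_funB => //; exact: measurable_funX.
  (* Independence is known for [S r'], so the factor [c] of [V] is absorbed into the function. *)
  have mfc : measurable_fun setT (fun x : R => f (c * x)).
    exact: measurableT_comp.
  have mf'c : measurable_fun setT (fun x : R => f' (c * x)).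
    exact: measurableT_comp.
  rewrite (independent_RintegralM (indXS ir') mq mf'c bq bf'V).
  rewrite (independent_RintegralM (indXS ir') mcR mfc (bcX i) bfV).
  rewrite EZ // EX mulr0 mul0r subr0.
  suff -> : \int[P]_w (s ^+ 2 * n%:R^-1 - (c * X i w) ^+ 2) = 0.
    by rewrite mul0r addr0.
  have bX2 : bounded_measurable (fun w => X i w ^+ 2).
    by under eq_fun do rewrite expr2; exact: bounded_measurableM.
  under eq_Rintegral do rewrite exprMn.
  rewrite EB; last 2 first.
  - exact: bounded_measurable_cst.
  - exact: bounded_measurableM (bounded_measurable_cst _) bX2.
  by rewrite Rintegral_probability_cst EZ // EX2 c2 (mulrC (s ^+ 2)) subrr.
have b1V : bounded_measurable (fun w => 1 + `|V w|).
  apply: bounded_measurableD; first exact: bounded_measurable_cst.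
  exact: bounded_measurable_norm.
apply: (@le_trans _ _ (\int[P]_w (n%:R^-1 * c * C1 * (1 + `|V w|)))).
  apply: Ele_norm => //.
    exact: bounded_measurableM (bounded_measurable_cst _) b1V.
  move=> w; rewrite /D.
  have cXb : `|c * X i w| <= c * b by rewrite normrM ger0_norm // ler_wpM2l.
  have cX0 : 0 <= `|c * X i w| by [].
  have WVE : W w - V w = c * X i w by rewrite WV addrC addKr.
  have KV : 0 <= K * (1 + `|V w|) by rewrite mulr_ge0 // addr_ge0.
  apply: (le_trans (ler_normB _ _)).
  (* The bound is split to match the two terms of [D], using [c ^+ 2 = n%:R^-1]. *)
  have -> : n%:R^-1 * c * C1 * (1 + `|V w|) =
      s ^+ 2 * n%:R^-1 * (K * (1 + `|V w|) * (c * b)) +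
      c * b * (K * (1 + `|V w|) * (c * b) ^+ 2).
    rewrite /C1 -c2; ring.
  apply: lerD; rewrite normrM; apply: ler_pM => //.
  - by rewrite ger0_norm // mulr_ge0 ?sqr_ge0 // invr_ge0.
  - apply: (le_trans (f'lip _ _)); rewrite WVE.
    by rewrite ler_wpM2l.
  - apply: (le_trans (ftaylor _ _)); rewrite WVE.
    by rewrite ler_wpM2l // lerXn2r ?nnegrE // mulr_ge0.
rewrite EZ // -[leLHS]mulrA ler_wpM2l //; last exact: ler_wpM2l.
by rewrite mulr_ge0 // invr_ge0.
Qed.

End bounded_clt.

(** * Convergence of the distribution functions *)

Section ramp.
Context {R : realType}.
Local Notation mu := (@lebesgue_measure R).

Definition ramp (a e x : R) : R := Num.max 0 (Num.min 1 ((a + e - x) / e)).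

Lemma ramp_itv (a e x : R) : 0 <= ramp a e x <= 1.
Proof. by rewrite /ramp le_max lexx /= ge_max ler01 ge_min lexx. Qed.

Lemma ramp1 (a e x : R) : 0 < e -> x <= a -> ramp a e x = 1.
Proof.
move=> e0 xa; rewrite /ramp (min_idPl _) ?(max_idPr _) // ler_pdivlMr //; lra.
Qed.

Lemma ramp0 (a e x : R) : 0 < e -> a + e < x -> ramp a e x = 0.
Proof.
move=> e0 xa; rewrite /ramp; apply/max_idPl; rewrite ge_min; apply/orP; right.
by rewrite ler_pdivrMr // mul0r; lra.
Qed.

(** Truncation to [0, 1] is 1-Lipschitz, so the slope of the affine part survives; the cases
    according to the position of [p] and [q] relative to 0 and 1 are linear. *)
Lemma ramp_lipschitz (a e x y : R) : 0 < e ->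
  `|ramp a e x - ramp a e y| <= e^-1 * `|x - y|.
Proof.
move=> e0; rewrite -[X in X * _]gtr0_norm ?invr_gt0 // -normrM /ramp.
have -> : e^-1 * (x - y) = (a + e - y) / e - (a + e - x) / e.
  by field; rewrite gt_eqF.
move: ((a + e - x) / e) ((a + e - y) / e) => p q.
have max01 : Num.max 0 (1 : R) = 1 by apply/max_idPr.
by case: (leP 1 p) => ?; case: (leP 1 q) => ?; case: (leP 0 p) => ?;
  case: (leP 0 q) => ?; case: (ler0P (q - p)) => ?; rewrite ?max01 ler_norml;
  apply/andP; split; lra.
Qed.

Lemma continuous_ramp (a e : R) : continuous (ramp a e).
Proof.
move=> x; set u := fun x : R => (a + e - x) / e.
have cu : {for x, continuous u}.
  apply: cvgM; last exact: cvg_cst.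
  by apply: cvgB; [exact: cvg_cst | exact: cvg_id].
have ccst (c : R) : {for x, continuous (fun _ : R => c)} by exact: cvg_cst.
exact: (continuous_max (ccst 0) (continuous_min (ccst 1) cu)).
Qed.

Lemma indic_le_ramp (a e x : R) : 0 < e -> \1_(`]-oo, a]) x <= ramp a e x.
Proof.
move=> e0; rewrite indicE mem_setE in_itv /=.
by case: (leP x a) => [xa|_]; [rewrite ramp1 | have /andP[] := ramp_itv a e x].
Qed.

Lemma ramp_le_indic (a e x : R) : 0 < e -> ramp a e x <= \1_(`]-oo, a + e]) x.
Proof.
move=> e0; rewrite indicE mem_setE in_itv /=.
by case: (leP x (a + e)) => [xa|xa]; [have /andP[] := ramp_itv a e x | rewrite ramp0].
Qed.

Lemma ramp_le_normal_prob (s a e : R) : 0 < e ->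
  \int[mu]_x (ramp a e x * normal_pdf 0 s x) <=
    fine (normal_prob 0 s `]-oo, a + e]) /\
  fine (normal_prob 0 s `]-oo, a]) <=
    \int[mu]_x (ramp a e x * normal_pdf 0 s x).
Proof.
move=> e0; rewrite /normal_prob -!/(Rintegral _ _ _).
have p0 x : 0 <= normal_pdf 0 s x by exact: normal_pdf_ge0.
have mp : measurable_fun setT (normal_pdf 0 s) by exact: measurable_normal_pdf.
have mr : measurable_fun setT (ramp a e).
  by apply: continuous_measurable_fun; exact: continuous_ramp.
have int_gp (g : R -> R) : measurable_fun setT g -> (forall x, 0 <= g x <= 1) ->
    mu.-integrable setT (EFin \o (fun x => g x * normal_pdf 0 s x)).
  move=> mg g01; apply: (le_integrable _ _ _ (integrable_normal_pdf 0 s)) => //.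
    by apply/measurable_EFinP; exact: measurable_funM.
  move=> x _ /=; have /andP[g0 g1] := g01 x.
  by rewrite lee_fin !ger0_norm ?mulr_ge0 // ler_piMl.
have restrE (A : set R) : measurable A -> \int[mu]_(x in A) normal_pdf 0 s x =
    \int[mu]_x (\1_A x * normal_pdf 0 s x).
  move=> mA; rewrite Rintegral_mkcond; apply: eq_Rintegral => x _.
  by rewrite /patch indicE; case: (x \in A); rewrite ?mul1r ?mul0r.
have ind01 (A : set R) (x : R) : 0 <= (\1_A x : R) <= 1.
  by rewrite indicE; case: (x \in A); rewrite /= ?ler01 ?lexx.
split; rewrite restrE //; apply: le_Rintegral => //;
  try (by apply: int_gp => //; move=> x; exact: ramp_itv);
  try (by apply: int_gp).
- by move=> x _; rewrite ler_wpM2r // ramp_le_indic.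
- by move=> x _; rewrite ler_wpM2r // indic_le_ramp.
Qed.

Lemma ramp_le_cdf (d : measure_display) (T : measurableType d)
    (P : probability T R) (Y : {RV P >-> R}) (a e : R) : 0 < e ->
  \int[P]_w ramp a e (Y w) <= fine (cdf Y (a + e)) /\
  fine (cdf Y a) <= \int[P]_w ramp a e (Y w).
Proof.
move=> e0.
have mY : measurable_fun setT (Y : T -> R) by exact: measurable_funPT.
have br : bounded_measurable (fun w => ramp a e (Y w)).
  apply: (bounded_measurable_comp (K := 1)) mY => [|x].
    by apply: continuous_measurable_fun; exact: continuous_ramp.
  by have /andP[r0 r1] := ramp_itv a e x; rewrite ger0_norm.
have bi c : bounded_measurable (fun w => \1_(`]-oo, c]) (Y w) : R).
  apply: (bounded_measurable_comp (K := 1)) mY => [|x].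
    exact: measurable_indic.
  by rewrite indicE; case: (x \in _); rewrite ?normr1 ?normr0 ?ler01.
have cdfE c : fine (cdf Y c) = \int[P]_w \1_(`]-oo, c]) (Y w).
  rewrite /Rintegral; congr fine.
  rewrite (eq_integral (fun w => (\1_(Y @^-1` `]-oo, c]) w)%:E)); last first.
    by move=> w _; rewrite !indicE.
  rewrite integral_indic // ?setIT //.
  by rewrite -[X in measurable X]setTI; exact: mY.
by split; rewrite cdfE; apply: le_Rintegral => //;
  try exact: bounded_measurable_integrable; move=> w _;
  rewrite ?ramp_le_indic ?indic_le_ramp.
Qed.

End ramp.

Lemma near_div_sqrt_le (R : realType) (C e : R) : 0 < e ->
  \forall n \near \oo, C * (Num.sqrt n%:R)^-1 <= e.
Proof.
move=> e0; pose N := Num.bound ((C / e) ^+ 2).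
exists N.+1 => // n /= Nn.
have n0 : 0 < n%:R :> R by rewrite ltr0n (leq_trans _ Nn).
rewrite ler_pdivrMr ?sqrtr_gt0 // mulrC -ler_pdivrMr //.
apply: (le_trans (ler_norm _)); rewrite -sqrtr_sqr ler_sqrt ?ltW //.
apply: (lt_le_trans (archi_boundP (sqr_ge0 _))).
by rewrite ler_nat ltnW.
Qed.

Section bounded_clt_cvg.
Context {d : measure_display} {T : measurableType d} {R : realType}.
Variables (P : probability T R) (X Y : nat -> {RV P >-> R}) (b s : R).
Hypotheses (indX : mutually_independent X) (s_gt0 : 0 < s)
  (Xb : forall i w, `|X i w| <= b) (EX : forall i, \int[P]_w X i w = 0)
  (EX2 : forall i, \int[P]_w (X i w ^+ 2) = s ^+ 2).
Hypothesis YE : forall n w, (0 < n)%N ->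
  Y n w = (Num.sqrt n%:R)^-1 * \sum_(i < n) X i w.

Lemma bounded_clt : cvg_in_distribution Y (normal_prob 0 s).
Proof.
move=> t; set nu : probability (measurableTypeR R) R := normal_prob 0 s.
have nu_fin c : nu `]-oo, c]%classic \is a fin_num by exact: fin_num_measure.
move=> cont_t.
have cdf_fin n : cdf (Y n) t \is a fin_num by exact: fin_num_measure.
rewrite -(fineK (nu_fin t)); apply: cvg_EFin; first by near=> n.
have {}cont_t : fine (nu `]-oo, c]%classic) @[c --> t] --> fine (nu `]-oo, t]%classic).
  by apply: fine_cvg; rewrite fineK.
apply/cvgrPdist_le => e e0.
have e2 : 0 < e / 2 by rewrite divr_gt0.
have /cvgrPdist_le/(_ _ e2)/nbhs_ballP[dl /= dl0 near_t] := cont_t.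
(* Half the radius keeps [t - r] and [t + r] inside the open ball where the normal distribution
   function varies by at most [e / 2]. *)
pose r := dl / 2.
have r0 : 0 < r by rewrite divr_gt0.
have near_le c : `|t - c| = r ->
    `|fine (nu `]-oo, t]%classic) - fine (nu `]-oo, c]%classic)| <= e / 2.
  by move=> tc; apply: near_t; rewrite /ball /= tc /r ltr_pdivrMr // ltr_pMr // ltr1n.
have sb a : exists C : R, forall n, (0 < n)%N ->
    `|\int[P]_w ramp a r (Y n w) -
      \int[lebesgue_measure]_x (ramp a r x * normal_pdf 0 s x)| <=
    C * (Num.sqrt n%:R)^-1.
  have rV0 : 0 <= r^-1 by rewrite invr_ge0 ltW.
  have [C HC] := stein_bound indX s_gt0 Xb EX EX2 (@continuous_ramp _ a r)
    (ramp_itv a r) rV0 (fun x y => ramp_lipschitz a x y r0).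
  exists C => n n0; apply: le_trans (HC n n0).
  rewrite le_eqVlt; apply/orP; left; apply/eqP; congr (`|_ - _|).
  by apply: eq_Rintegral => w _; rewrite YE.
(* The ramp descending on [t - r, t] lies below the indicator of the half-line up to [t], the one
   descending on [t, t + r] above it. Stein's bound costs [e / 2], and so does moving [t] by [r]. *)
have [C1 H1] := sb (t - r); have [C2 H2] := sb t.
near=> n.
have n0 : (0 < n)%N by near: n; exact: nbhs_infty_gt.
have /ler_normlP[h1 h1'] := H1 n n0; have /ler_normlP[h2 h2'] := H2 n n0.
have C1e : C1 * (Num.sqrt n%:R)^-1 <= e / 2.
  by near: n; exact: near_div_sqrt_le.
have C2e : C2 * (Num.sqrt n%:R)^-1 <= e / 2.
  by near: n; exact: near_div_sqrt_le.
have [a1 a2] := ramp_le_normal_prob s (t - r) r0.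
have [b1 b2] := ramp_le_normal_prob s t r0.
have [c1 c2] := ramp_le_cdf (Y n) (t - r) r0.
have [d1 d2] := ramp_le_cdf (Y n) t r0.
rewrite subrK in a1 c1.
have /ler_normlP[u1 u1'] : `|fine (nu `]-oo, t]%classic) - fine (nu `]-oo, t - r]%classic)| <= e / 2.
  by apply: near_le; rewrite subKr gtr0_norm.
have /ler_normlP[u2 u2'] : `|fine (nu `]-oo, t]%classic) - fine (nu `]-oo, t + r]%classic)| <= e / 2.
  by apply: near_le; rewrite opprD addNKr normrN gtr0_norm.
rewrite /= ler_norml; apply/andP; split; rewrite /nu in u1 u1' u2 u2' *; lra.
Unshelve. all: by end_near.
Qed.

End bounded_clt_cvg.

(** * Bounded i.i.d. variables *)

(** Permits replacing the given variables by almost surely equal ones that are bounded everywhere or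
    constant. *)
Lemma cdf_ae_eq (d : measure_display) (T : measurableType d) (R : realType)
    (P : probability T R) (U V : {RV P >-> R}) (t : R) :
  {ae P, forall w, U w = V w} -> cdf U t = cdf V t.
Proof.
move=> UV; have mE (W : {RV P >-> R}) : measurable (W @^-1` `]-oo, t]).
  by rewrite -[X in measurable X]setTI; exact: measurable_funPT.
have cdfE (W : {RV P >-> R}) :
    cdf W t = (\int[P]_w (\1_(W @^-1` `]-oo, t]) w)%:E)%E.
  by rewrite integral_indic // setIT.
rewrite !cdfE; apply: ae_eq_integral => //.
- by apply/measurable_EFinP; exact: measurable_indic.
- by apply/measurable_EFinP; exact: measurable_indic.
apply: filterS UV => w UVw _; rewrite !indicE; congr ((nat_of_bool _)%:R%:E).
by apply/idP/idP => /set_mem/= wt; apply/mem_set; rewrite /= ?UVw // -UVw.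
Qed.

Section iid_clt.
Context {d d' : measure_display} {T : measurableType d} {T' : measurableType d'}
  {R : realType}.
Variables (alpha : probability T' R) (z : T' -> R).
Hypothesis bz : bounded_measurable z.
Variables (P : probability T R) (Z : nat -> {RV P >-> R}).
Hypothesis iidZ : iid Z (pushforward alpha z).

Let mz : measurable_fun setT z. Proof. by case: bz. Qed.

Let m := \int[alpha]_y z y.

(** Both sides are integrals of [g] against the common law. The bound is on [g] itself, since [Z i]
    is not bounded pointwise. *)
Let transfer (g : R -> R) (K : R) i : measurable_fun setT g ->
  (forall x, `|g x| <= K) ->
  \int[P]_w g (Z i w) = \int[alpha]_y g (z y).
Proof.
move=> mg gK; pose z' : {RV alpha >-> R} := mfun_Sub (mem_set mz).
have mgE : measurable_fun setT (EFin \o g) by exact/measurable_EFinP.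
rewrite /Rintegral; congr fine.
rewrite -(@integral_distribution _ _ _ _ _ P (Z i) (EFin \o g)) //; last first.
  apply: bounded_measurable_integrable.
  by apply: bounded_measurable_comp gK _ => //; exact: measurable_funPT.
rewrite -(@integral_distribution _ _ _ _ _ alpha z' (EFin \o g)) //; last first.
  apply: bounded_measurable_integrable.
  exact: bounded_measurable_comp gK _.
apply: eq_measure_integral => A mA _; case: iidZ => _ lawZ; exact: lawZ.
Qed.

Let variance_z : fine ('V_alpha[z])%E = \int[alpha]_y ((z y - m) ^+ 2).
Proof.
have bzm : bounded_measurable (fun y => z y - m).
  by apply: bounded_measurableB => //; exact: bounded_measurable_cst.
have Ez : fine ('E_alpha[z])%E = m by rewrite expectation_Rintegral.
pose zz y := (z y - m) * (z y - m).
rewrite /variance unlock Ez -[LHS]/(fine ('E_alpha[zz])%E).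
rewrite expectation_Rintegral; last exact: bounded_measurableM.
by apply: eq_Rintegral => y _; rewrite expr2.
Qed.

Lemma iid_clt :
  cvg_in_distribution (fun n => scaled_error Z m n : {RV P >-> R})
    (normal_law 0 (fine ('V_alpha[z])%E)).
Proof.
have [_ [B zB]] := bz.
have B0 : 0 <= B by exact: le_trans (zB point).
have mcl : measurable_fun setT (clamp B) by exact: measurable_clamp.
have mclZ i : measurable_fun setT (fun w => clamp B (Z i w)).
  by apply: measurableT_comp => //; exact: measurable_funPT.
have mX i : measurable_fun setT (fun w => clamp B (Z i w) - m).
  exact: measurable_funB.
(* [Z i] is bounded by [B] only almost surely, while its truncation is
   bounded everywhere. *)
pose Z' i : {RV P >-> R} := mfun_Sub (mem_set (mclZ i)).
pose X i : {RV P >-> R} := mfun_Sub (mem_set (mX i)).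
have Xb i w : `|X i w| <= B + `|m|.
  by apply: (le_trans (ler_normB _ _)); rewrite lerD2r normr_clamp.
have mphi : measurable_fun setT (fun x => clamp B x - m).
  exact: measurable_funB.
have indX : mutually_independent X.
  case: iidZ => indZ _.
  exact: (mutually_independent_comp (phi := fun x => clamp B x - m)) indZ.
have phib x : `|clamp B x - m| <= B + `|m|.
  by apply: (le_trans (ler_normB _ _)); rewrite lerD2r normr_clamp.
have EX i : \int[P]_w X i w = 0.
  rewrite (transfer i mphi phib).
  under eq_Rintegral do rewrite clamp_id //.
  rewrite RintegralB //; last 2 first.
  - exact: bounded_measurable_integrable.
  - exact/bounded_measurable_integrable/bounded_measurable_cst.
  by rewrite Rintegral_probability_cst subrr.
have EX2 i : \int[P]_w (X i w ^+ 2) = fine ('V_alpha[z])%E.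
  rewrite variance_z.
  rewrite (@transfer (fun x => (clamp B x - m) ^+ 2) ((B + `|m|) ^+ 2)).
  - by under eq_Rintegral do rewrite clamp_id //.
  - exact: measurable_funX.
  - by move=> x; rewrite normrX lerXn2r ?nnegrE // addr_ge0.
have aeZ : {ae P, forall w, forall i, Z i w = Z' i w}.
  apply: ae_foralln => i.
  (* [z] never enters [N], so the common law gives it mass 0. *)
  pose N := ~` [set` `[- B, B]] : set R.
  have mN : measurable N by exact: measurableC.
  exists (Z i @^-1` N); split.
  - by rewrite -[X in measurable X]setTI; exact: measurable_funPT.
  - case: iidZ => _ lawZ; rewrite -[LHS]/(distribution P (Z i) N) lawZ //.
    rewrite /pushforward (_ : z @^-1` N = set0) ?measure0 //.
    by rewrite -subset0 => y; apply; rewrite /= in_itv /= -ler_norml.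
  - move=> w /= ZZ' ZN; apply: ZZ'; rewrite clamp_id // ler_norml.
    by move: ZN; rewrite /= in_itv.
rewrite /normal_law; case: eqVneq => [v0|v_neq0].
  move=> t _.
  (* In the degenerate case the nonnegative [X i w ^+ 2] has integral 0, so every [Z i] equals [m]
     almost surely. *)
  have aeX : {ae P, forall w, forall i, X i w = 0}.
    apply: ae_foralln => i.
    have mX2 : measurable_fun setT (fun w => X i w ^+ 2).
      by apply: measurable_funX; exact: mX.
    have bX2 : bounded_measurable (fun w => X i w ^+ 2).
      split=> //; exists ((B + `|m|) ^+ 2) => w.
      by rewrite normrX lerXn2r ?nnegrE // addr_ge0.
    have : (\int[P]_w `|(X i w ^+ 2)%:E| = 0)%E.
      rewrite (eq_integral (fun w => (X i w ^+ 2)%:E)); last first.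
        by move=> w _; rewrite /= ger0_norm ?sqr_ge0.
      rewrite -[LHS]fineK; first by congr EFin; rewrite -v0 -(EX2 i).
      by apply: integrable_fin_num => //; exact: bounded_measurable_integrable.
    move=> /(ae_eq_integral_abs P measurableT _).1 aeX2.
    have {}aeX2 := aeX2 ((measurable_EFinP _ _).2 mX2).
    apply: filterS aeX2 => w /(_ I) [] /eqP.
    by rewrite expf_eq0 => /andP[_ /eqP].
  pose Y0 : {RV P >-> R} := mfun_Sub (mem_set (@measurable_cst _ _ T R setT 0)).
  have ae0 n : {ae P, forall w, scaled_error Z m n w = Y0 w}.
    apply: filterS2 aeZ aeX => w Zw Xw.
    rewrite /scaled_error /=.
    (* For [n = 0] the inverse is a default value, annihilated by the factor [Num.sqrt 0]. *)
    have [->|n0] := posnP n; first by rewrite sqrtr0 mul0r.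
    have -> : \sum_(i < n) Z i w = \sum_(i < n) m.
      by apply: eq_bigr => i _; rewrite Zw -[RHS]add0r -(Xw i) subrK.
    rewrite sumr_const card_ord -[m *+ n]mulr_natl mulKf ?subrr ?mulr0 //.
    by rewrite pnatr_eq0 -lt0n.
  (* The distribution functions at [t] form a constant sequence, that of the point mass at 0. *)
  rewrite (_ : (fun n => _) =
      (fun=> dirac (0 : measurableTypeR R) `]-oo, t]%classic)).
    exact: cvg_cst.
  apply/funext => n; rewrite (cdf_ae_eq t (ae0 n)).
  rewrite /cdf /distribution /pushforward diracE.
  have [t0|t0] := leP 0 t.
    rewrite mem_set /=; last by rewrite in_itv.
    rewrite (_ : _ @^-1` _ = setT) ?probability_setT //.
    by apply/seteqP; split => // w _ /=; rewrite in_itv.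
  rewrite memNset /=; last by rewrite in_itv /= leNgt t0.
  rewrite (_ : _ @^-1` _ = set0) ?measure0 //.
  by rewrite -subset0 => w /=; rewrite in_itv /= leNgt t0.
have v_gt0 : 0 < fine ('V_alpha[z])%E.
  by rewrite lt_def v_neq0 fine_ge0 // variance_ge0.
set s := Num.sqrt _; have s0 : 0 < s by rewrite sqrtr_gt0.
have s2 : s ^+ 2 = fine ('V_alpha[z])%E by rewrite sqr_sqrtr // ltW.
have EX2s i : \int[P]_w (X i w ^+ 2) = s ^+ 2 by rewrite s2.
have YE n w : (0 < n)%N -> (scaled_error Z' m n : {RV P >-> R}) w =
    (Num.sqrt n%:R)^-1 * \sum_(i < n) X i w.
  move=> n0; rewrite /= /scaled_error.
  have sn : Num.sqrt n%:R != 0 :> R by rewrite gt_eqF // sqrtr_gt0 ltr0n.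
  have nE : n%:R = Num.sqrt n%:R ^+ 2 :> R by rewrite sqr_sqrtr.
  rewrite sumrB sumr_const card_ord -[m *+ n]mulr_natl.
  move: (\sum_(i < n) Z' i w) => x.
  by move: (Num.sqrt n%:R) sn nE => q q0 ->; field.
move=> t cont_t.
have := bounded_clt indX s0 Xb EX EX2s YE cont_t.
rewrite (_ : (fun n => cdf _ t) =
  (fun n => cdf (scaled_error Z m n : {RV P >-> R}) t)) //.
apply/funext => n; apply: cdf_ae_eq; apply: filterS aeZ => w Zw.
by rewrite /= /scaled_error; under eq_bigr do rewrite -Zw.
Qed.

End iid_clt.

(** * The kernel statistic *)

Section euclidean.
Context {R : realType} {d : nat}.

(** Open intervals generate the Borel sets of the line, and their preimages under the continuous
    coordinate are open, hence generators of [borel_rV]. *)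
Lemma measurable_coord (i : 'I_d) :
  measurable_fun [set: borel_rV R d] (fun y : borel_rV R d => (y : 'rV[R]_d) 0 i).
Proof.
apply: (measurability _ (RGenOpens.measurableE R)).
move=> _ [_ [a [b ->] <-]]; rewrite setTI; apply: sub_sigma_algebra.
have /continuousP := @coord_continuous R 1 d 0 i; apply.
exact: interval_open.
Qed.

Lemma measurable_subr_coord (x : 'rV[R]_d) (i : 'I_d) :
  measurable_fun [set: borel_rV R d] (fun y : borel_rV R d => (y - x : 'rV[R]_d) 0 i).
Proof.
under eq_fun do rewrite !mxE.
by apply: measurable_funB => //; exact: measurable_coord.
Qed.

Lemma dotp_ge0 (w : 'rV[R]_d) : 0 <= dotp w w.
Proof. by apply: sumr_ge0 => i _; rewrite -expr2 sqr_ge0. Qed.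

Lemma sqr_enorm (w : 'rV[R]_d) : enorm w ^+ 2 = dotp w w.
Proof. by rewrite sqr_sqrtr // dotp_ge0. Qed.

(** By 2 |a b| <= a^2 + b^2, each square being at most the full sum. *)
Lemma normr_mul_coord_le (w : 'rV[R]_d) (i j : 'I_d) :
  `|w 0 i * w 0 j| <= dotp w w.
Proof.
have sqr_le k : w 0 k ^+ 2 <= dotp w w.
  rewrite /dotp (bigD1 k) //= -expr2 lerDl.
  by apply: sumr_ge0 => l _; rewrite -expr2 sqr_ge0.
have := sqr_le i; have := sqr_le j.
rewrite -[w 0 i ^+ 2]real_normK ?num_real // -[w 0 j ^+ 2]real_normK ?num_real //.
rewrite normrM; have := sqr_ge0 (`|w 0 i| - `|w 0 j|).
nra.
Qed.

End euclidean.

Section kernel.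
Context {R : realType} {d : nat}.
Variables (f : R -> R) (f_adm : admissible_profile d f) (sigma : R)
  (sigma_gt0 : 0 < sigma) (alpha : probability (borel_rV R d) R).
Variables (x : 'rV[R]_d).

Let s2 : 0 < sigma ^+ 2. Proof. exact: exprn_gt0. Qed.

Let arg_ge0 y : 0 <= enorm (y - x) ^+ 2 / sigma ^+ 2.
Proof. by rewrite divr_ge0 ?sqr_ge0. Qed.

Lemma measurable_multiscale_kernel :
  measurable_fun [set: borel_rV R d]
    (fun y : borel_rV R d => multiscale_kernel f x y sigma).
Proof.
apply: measurable_funM => //.
(* The profile is measurable on the half-line only, so the composition passes through it; the
   argument of [f] is nonnegative. *)
apply: (measurable_comp (F := `[(0 : R), +oo[%classic) (f := f)) => //.
- by move=> _ [y _ <-] /=; rewrite in_itv /= andbT.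
- exact: profile_measurable f_adm.
- apply: measurable_funM => //.
  under eq_fun do rewrite sqr_enorm.
  apply: measurable_sum => i.
  by apply: measurable_funM; exact: measurable_subr_coord.
Qed.

(* By the decay condition, [|y - x|^2 f(|y - x|^2 / sigma^2) <= C sigma^2]. *)
Lemma bounded_coord_kernel (i j : 'I_d) :
  @bounded_measurable _ (borel_rV R d) R
    (fun y => (y - x) 0 i * (y - x) 0 j * multiscale_kernel f x y sigma).
Proof.
split.
  apply: measurable_funM; last exact: measurable_multiscale_kernel.
  by apply: measurable_funM; exact: measurable_subr_coord.
have [C C0 HC] := profile_decay f_adm.
exists (`|(kernel_cst d f sigma)^-1| * (C * sigma ^+ 2)) => y.
have f0 := profile_ge0 f_adm (arg_ge0 y).
rewrite /multiscale_kernel mulrCA normrM ler_wpM2l // normrM (ger0_norm f0).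
apply: (@le_trans _ _ (enorm (y - x) ^+ 2 *
    f (enorm (y - x) ^+ 2 / sigma ^+ 2))).
  by rewrite ler_wpM2r // sqr_enorm normr_mul_coord_le.
rewrite -ler_pdivrMr // mulrAC; exact: HC.
Qed.

(** The covariance tensor is integrated entry by entry, so boundedness and the mean of [z_var] are
    both obtained from this expansion. *)
Let z_varE (u v y : 'rV[R]_d) : z_var f u v x sigma y =
  \sum_(i < d) \sum_(j < d) (u 0 i * v 0 j) *
    ((y - x) 0 i * (y - x) 0 j * multiscale_kernel f x y sigma).
Proof.
rewrite /z_var /dotp mulr_suml mulr_suml; apply: eq_bigr => i _.
rewrite mulr_sumr mulr_suml; apply: eq_bigr => j _.
by ring.
Qed.

Lemma bounded_z_var (u v : 'rV[R]_d) :
  @bounded_measurable _ (borel_rV R d) R (z_var f u v x sigma).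
Proof.
have -> : z_var f u v x sigma = (fun y => \sum_(i < d) \sum_(j < d)
    (u 0 i * v 0 j) *
      ((y - x) 0 i * (y - x) 0 j * multiscale_kernel f x y sigma)).
  by apply/funext => y; exact: z_varE.
apply: bounded_measurable_sum => i; apply: bounded_measurable_sum => j.
apply: bounded_measurableM; first exact: bounded_measurable_cst.
exact: bounded_coord_kernel.
Qed.

Lemma tensor_form_covariance (u v : 'rV[R]_d) :
  tensor_form (covariance_tensor f alpha x sigma) u v =
  \int[alpha]_y z_var f u v x sigma y.
Proof.
have bt i j : @bounded_measurable _ (borel_rV R d) R (fun y => (u 0 i * v 0 j) *
    ((y - x) 0 i * (y - x) 0 j * multiscale_kernel f x y sigma)).
  apply: bounded_measurableM; first exact: bounded_measurable_cst.
  exact: bounded_coord_kernel.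
have -> : \int[alpha]_y z_var f u v x sigma y =
    \int[alpha]_y (\sum_(i < d) \sum_(j < d) (u 0 i * v 0 j) *
      ((y - x) 0 i * (y - x) 0 j * multiscale_kernel f x y sigma)).
  by apply: eq_Rintegral => y _; exact: z_varE.
rewrite Rintegral_sum; last by move=> i; exact: bounded_measurable_sum.
rewrite /tensor_form mxE.
under eq_bigr do rewrite !mxE mulr_suml.
(* The product [u *m T *m v^T] sums over the column index outside, the expansion of [z_var] over the
   row index. *)
rewrite exchange_big; apply: eq_bigr => i _ /=.
rewrite Rintegral_sum //; apply: eq_bigr => j _.
rewrite RintegralZl //; last first.
  exact/bounded_measurable_integrable/bounded_coord_kernel.
rewrite mxE mulrAC; congr (_ * _); apply: eq_Rintegral => y _.
by rewrite /tensor mxE big_ord1 !mxE.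
Qed.

End kernel.

(** Integrability stands beside finite variance because ['V_alpha[z]] is centred at [fine] of the
    mean, which is the mean only when that is finite. *)
Theorem theorem5 (R : realType) (d : nat) (d_gt0 : (0 < d)%N) (f : R -> R)
    (f_adm : admissible_profile d f) (alpha : probability (borel_rV R d) R)
    (u v x : 'rV[R]_d) (sigma : R) (sigma_gt0 : 0 < sigma) :
  let z := z_var f u v x sigma in
  [/\ alpha.-integrable [set: borel_rV R d] (EFin \o z),
      ('V_alpha[z] < +oo)%E &
      forall (dO : measure_display) (Omega : measurableType dO)
        (P : probability Omega R) (Z : nat -> {RV P >-> R}),
        iid Z (pushforward alpha z) ->
        cvg_in_distribution
          (fun n => scaled_error Z
             (tensor_form (covariance_tensor f alpha x sigma) u v) n
             : {RV P >-> R})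
          (normal_law 0 (fine 'V_alpha[z]))].
Proof.
move=> z.
have bz := bounded_z_var f_adm sigma_gt0 x u v.
split; first exact: bounded_measurable_integrable.
- rewrite /variance unlock expectation_Rintegral ?ltry //.
  by apply: bounded_measurableM; apply: bounded_measurableB => //;
    exact: bounded_measurable_cst.
- move=> dO Omega P Z iidZ.
  rewrite tensor_form_covariance //; exact: iid_clt.
Qed.
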